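(* Let $K$ be a finite set with $|K|\ge2$. For all $p,q\in\Delta(K)$ and all $u,v\in\mathcal U$ such that $\mathrm{marg}_Ku=p$ and $\mathrm{marg}_Kv=q$, $$\sum_{k\in K}|p_k-q_k|\ \le\ d(u,v)\ \le\ 2\Big(1-\max_{p',q'\in\Delta(K)}\sum_{k\in K}\min(p_kq'_k,\,p'_kq_k)\Big).$$ If $p=q$, the upper bound is equal to $2(1-\max_{k}p_k)$.
   Context: $\mathcal U=\Delta(K\times\mathbb N\times\mathbb N)$ is the set of information structures, i.e. probabilities on triples $(k,c,d)$; $k$ is the state, $c$ the signal of player 1 (maximizer), $d$ the signal of player 2 (minimizer). A payoff function is a map $g:K\times I\times J\to[-1,1]$ with $I,J$ finite nonempty sets; $\mathcal G$ is the set of all payoff functions. $\mathrm{val}(u,g)$ is the value of the zero-sum Bayesian game in which $(k,c,d)\sim u$, player 1 learns $c$, player 2 learns $d$, they simultaneously choose $i\in I$, $j\in J$ (mixed actions depending on own signal allowed), and player 1 receives $g(k,i,j)$ from player 2. $d(u,v)=\sup_{g\in\mathcal G}|\mathrm{val}(u,g)-\mathrm{val}(v,g)|$. $\mathrm{marg}_K u$ is the marginal law of $k$ under $u$. *)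

(* Defs.v *)
From HB Require Import structures.
From mathcomp Require Import all_boot all_order all_algebra.
From mathcomp Require Import all_classical all_reals all_analysis.
From mathcomp Require Import finmap ring lra.

Set Implicit Arguments.
Unset Strict Implicit.
Unset Printing Implicit Defensive.

Import Order.TTheory GRing.Theory Num.Theory.
Import numFieldNormedType.Exports.

Local Open Scope classical_set_scope.
Local Open Scope ring_scope.

(* Probabilities on a (typically countable) set, given by their mass
   functions. *)
Definition Delta (R : realType) (T : choiceType) : set (T -> R) :=
  [set p | (forall t, 0 <= p t) /\ \esum_(t in [set: T]) (p t)%:E = 1%E].
Arguments Delta : clear implicits.

(* A triple (k, c, d) is the nested pair ((k, c), d). *)
Definition info_structure (R : realType) (K : finType) :
    set (K * nat * nat -> R) := Delta R (K * nat * nat)%type.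
Arguments info_structure : clear implicits.

Definition marg (R : realType) (K : finType) (u : K * nat * nat -> R) : K -> R :=
  fun k => fine (\esum_(s in [set: nat * nat]) (u (k, s.1, s.2))%:E).

(* The sum of u t * f t over t: [esum] is only meaningful for nonnegative
   terms, hence the positive and negative parts. *)
Definition expect (R : realType) (T : choiceType) (u f : T -> R) : R :=
  let F := fun t => (u t * f t)%:E in
  fine (esum [set: T] (F^\+)%E - esum [set: T] (F^\-)%E)%E.

Definition payoff_fun (R : realType) (K I J : finType) :
    set (K -> I -> J -> R) :=
  [set g | forall k i j, -1 <= g k i j <= 1].
Arguments payoff_fun : clear implicits.

Definition strategy (R : realType) (I : finType) : set (nat -> I -> R) :=
  [set s | forall c, Delta R I (s c)].
Arguments strategy : clear implicits.

Definition payoff (R : realType) (K I J : finType) (u : K * nat * nat -> R)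
    (g : K -> I -> J -> R) (s : nat -> I -> R) (t : nat -> J -> R) : R :=
  expect u (fun x => let: (k, c, d) := x in
    \sum_i \sum_j s c i * t d j * g k i j).

Definition maxmin (R : realType) (K I J : finType) (u : K * nat * nat -> R)
    (g : K -> I -> J -> R) : R :=
  sup [set inf [set payoff u g s t | t in strategy R J] | s in strategy R I].

Definition minmax (R : realType) (K I J : finType) (u : K * nat * nat -> R)
    (g : K -> I -> J -> R) : R :=
  inf [set sup [set payoff u g s t | s in strategy R I] | t in strategy R J].

(* The lower value; it is also the upper value, by [maxmin_minmax] below. *)
Definition game_val (R : realType) (K I J : finType) (u : K * nat * nat -> R)
    (g : K -> I -> J -> R) : R := maxmin u g.

Definition val_dist (R : realType) (K : finType) (u v : K * nat * nat -> R) : R :=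
  sup [set x | exists (I J : finType) (g : K -> I -> J -> R),
    [/\ (0 < #|I|)%N, (0 < #|J|)%N, payoff_fun R K I J g
      & x = `|game_val u g - game_val v g| ] ].

(* The supremum is a maximum, by [overlap_attained] below. *)
Definition overlap (R : realType) (K : finType) (p q : K -> R) : R :=
  sup [set \sum_k Num.min (p k * q' k) (p' k * q k)
       | p' in Delta R K & q' in Delta R K].

(* The rest of the file shows that every game has a value and that the
   supremum defining [overlap] is attained. *)

Section finite_games.
Context {R : realType}.

Definition pos_part (x : R) : R := Num.max 0 x.

Lemma pos_part_ge0 x : 0 <= pos_part x. Proof. by rewrite /pos_part le_max lexx. Qed.
Hint Resolve pos_part_ge0 : core.

Lemma pos_part_sq a b :
  pos_part (a + b) ^+ 2 <= pos_part a ^+ 2 + 2 * (pos_part a * b) + b ^+ 2.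
Proof. by rewrite /pos_part; case: (leP 0 (a + b)); case: (leP 0 a) => *; nra. Qed.

Definition is_mixed (C I : finType) (s : C -> I -> R) :=
  forall c, (forall i, 0 <= s c i) /\ \sum_i s c i = 1.

Section regret.
Variables (C I : finType) (i0 : I).

Definition matching (Q : C -> I -> R) (c : C) (i : I) : R :=
  if \sum_j pos_part (Q c j) == 0 then (i == i0)%:R
  else pos_part (Q c i) / \sum_j pos_part (Q c j).

Lemma matching_mixed Q : is_mixed (matching Q).
Proof.
move=> c; rewrite /matching; case: eqP => [_|/eqP S0].
  split=> [i|]; first by rewrite ler0n.
  by rewrite (bigD1 i0)//= eqxx big1 ?addr0// => i /negbTE ->.
split=> [i|]; last by rewrite -mulr_suml divff.
by rewrite divr_ge0// sumr_ge0.
Qed.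

Lemma matching_orth Q (w : C -> I -> R) c :
  \sum_i pos_part (Q c i) * (w c i - \sum_j matching Q c j * w c j) = 0.
Proof.
under eq_bigr do rewrite mulrBr.
rewrite sumrB -mulr_suml.
apply/eqP; rewrite subr_eq0; apply/eqP; rewrite /matching.
case: eqP => [S0|/eqP S0].
  rewrite S0 mul0r big1// => i _.
  by move/eqP: S0; rewrite psumr_eq0// => /allP/(_ i); rewrite mem_index_enum
    => /(_ isT)/= /eqP ->; rewrite mul0r.
rewrite mulr_sumr; apply: eq_bigr => i _.
by rewrite mulrA mulrCA divff// mulr1.
Qed.

Lemma mixed_bound (s w : C -> I -> R) (M : R) c : is_mixed s ->
  (forall c i, `|w c i| <= M) -> `|\sum_j s c j * w c j| <= M.
Proof.
move=> /(_ c)[s0 s1] wM; apply: le_trans (ler_norm_sum _ _ _) _.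
rewrite -[leRHS]mul1r -s1 mulr_suml ler_sum// => i _.
by rewrite normrM ger0_norm// ler_wpM2l.
Qed.

Definition regret_potential (Q : C -> I -> R) := \sum_c \sum_i pos_part (Q c i) ^+ 2.

Lemma regret_potential_step (Q Q' w : C -> I -> R) (M : R) :
  (forall c i, `|w c i| <= M) ->
  (forall c i, Q' c i = Q c i + (w c i - \sum_j matching Q c j * w c j)) ->
  regret_potential Q' <= regret_potential Q + \sum_(c : C) \sum_(i : I) (2 * M) ^+ 2.
Proof.
move=> wM Q'E; rewrite /regret_potential -big_split/= ler_sum// => c _.
set r := fun i => w c i - \sum_j matching Q c j * w c j.
apply: (@le_trans _ _ (\sum_i pos_part (Q c i) ^+ 2 + 2 * (\sum_i pos_part (Q c i) * r i)
   + \sum_i r i ^+ 2)).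
  rewrite mulr_sumr -!big_split/= ler_sum// => i _.
  by rewrite Q'E; exact: pos_part_sq.
rewrite matching_orth mulr0 addr0 lerD2l ler_sum// => i _.
have /ler_normlP[h1 h2] := wM c i.
have /ler_normlP[h3 h4] := mixed_bound c (matching_mixed Q) wM.
have : 0 <= (2 * M - r i) * (2 * M + r i) by rewrite mulr_ge0//; rewrite /r; lra.
by nra.
Qed.


Lemma regret_matching (Q w : nat -> C -> I -> R) (M e : R) : 0 < e ->
  (forall n c i, `|w n c i| <= M) ->
  (forall c i, Q 0 c i = 0) ->
  (forall n c i, Q n.+1 c i =
     Q n c i + (w n c i - \sum_j matching (Q n) c j * w n c j)) ->
  exists n0 : nat, forall n, (n0 <= n)%N -> forall s, is_mixed s ->
    \sum_(t < n) \sum_c \sum_i s c i * w t c i -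
    \sum_(t < n) \sum_c \sum_i matching (Q t) c i * w t c i <= e * n%:R.
Proof.
move=> e0 wM Q0 QS.
pose N : R := \sum_(c : C) \sum_(i : I) (2 * M) ^+ 2.
pose e' : R := e / (#|C|%:R + 1).
have C1 : 0 < #|C|%:R + 1 :> R by rewrite ltr_wpDl.
have e'0 : 0 < e' by rewrite divr_gt0.
exists (Num.truncn (N / e' ^+ 2)).+1 => n n0n s sm.
have nN : N / e' ^+ 2 <= n%:R.
  by apply: le_trans (ltW (truncnS_gt _)) _; rewrite ler_nat.
have PhiN k : regret_potential (Q k) <= k%:R * N.
  elim: k => [|k IH].
    rewrite mul0r /regret_potential big1// => c _; rewrite big1// => i _.
    by rewrite Q0 /pos_part maxxx expr0n.
  apply: le_trans (regret_potential_step (wM k) (QS k)) _.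
  have -> : k.+1%:R * N = k%:R * N + N by rewrite -[k.+1%:R]natr1 mulrDl mul1r.
  exact: lerD.
have Qn c i : Q n c i <= e' * n%:R.
  have h1 : pos_part (Q n c i) ^+ 2 <= (e' * n%:R) ^+ 2.
    apply: (@le_trans _ _ (n%:R * N)).
      apply: le_trans (PhiN n); rewrite /regret_potential (bigD1 c)//= (bigD1 i)//=.
      rewrite -addrA lerDl addr_ge0 ?sumr_ge0// => *; rewrite ?sqr_ge0//.
      by rewrite sumr_ge0// => *; rewrite sqr_ge0.
    have -> : (e' * n%:R) ^+ 2 = n%:R * (n%:R * e' ^+ 2) by ring.
    rewrite ler_pM2l; last by rewrite ltr0n (leq_trans _ n0n).
    by rewrite -ler_pdivrMr ?exprn_gt0.
  rewrite (@le_trans _ _ (pos_part (Q n c i)))// ?le_max ?lexx ?orbT//.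
  by rewrite -(@ler_pXn2r _ 2)// nnegrE// mulr_ge0// ltW.
have QE c i : Q n c i = \sum_(t < n) (w t c i - \sum_j matching (Q t) c j * w t c j).
  elim: (n) => [|k IH]; first by rewrite Q0 big_ord0.
  by rewrite QS IH big_ord_recr.
have -> : \sum_(t < n) \sum_c \sum_i s c i * w t c i -
    \sum_(t < n) \sum_c \sum_i matching (Q t) c i * w t c i =
    \sum_c \sum_i s c i * Q n c i.
  rewrite -sumrB.
  under [RHS]eq_bigr do under eq_bigr do rewrite QE mulr_sumr.
  under [RHS]eq_bigr do rewrite exchange_big/=.
  rewrite [RHS]exchange_big/=; apply: eq_bigr => t _.
  rewrite -sumrB; apply: eq_bigr => c _.
  under [RHS]eq_bigr do rewrite mulrBr.
  by rewrite sumrB -mulr_suml (sm c).2 mul1r.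
apply: (@le_trans _ _ (\sum_(c : C) e' * n%:R)).
  apply: ler_sum => c _; have [s0 s1] := sm c.
  have -> : e' * n%:R = \sum_i s c i * (e' * n%:R) by rewrite -mulr_suml s1 mul1r.
  by rewrite ler_sum// => i _; rewrite ler_wpM2l.
rewrite sumr_const -[leLHS]mulr_natr mulrAC ler_wpM2r//.
by rewrite /e' mulrAC ler_pdivrMr// ler_pM2l// lerDl.
Qed.

End regret.

(* Both players use regret matching against each other; their average
   strategies are then almost optimal. *)
Lemma finite_game_minimax (C D I J : finType) (i0 : I) (j0 : J)
    (B : C -> I -> D -> J -> R) (e : R) : 0 < e ->
  let pay s t := \sum_c \sum_i \sum_d \sum_j s c i * t d j * B c i d j in
  exists s t, [/\ is_mixed s, is_mixed t &
    forall s' t', is_mixed s' -> is_mixed t' -> pay s' t <= pay s t' + e].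
Proof.
move=> e0 pay.
pose w1 t c i := \sum_d \sum_j t d j * B c i d j.
pose w2 s d j := - \sum_c \sum_i s c i * B c i d j.
pose upd (A L : finType) (a0 : L) (Q w : A -> L -> R) c i :=
  Q c i + (w c i - \sum_j matching a0 Q c j * w c j).
pose step (X : (C -> I -> R) * (D -> J -> R)) :=
  (upd C I i0 X.1 (w1 (matching j0 X.2)), upd D J j0 X.2 (w2 (matching i0 X.1))).
pose X n := iter n step (fun _ _ => 0, fun _ _ => 0).
pose s n := matching i0 (X n).1.
pose t n := matching j0 (X n).2.
have sm n : is_mixed (s n) by exact: matching_mixed.
have tm n : is_mixed (t n) by exact: matching_mixed.
have pay1 s' t' : pay s' t' = \sum_c \sum_i s' c i * w1 t' c i.
  rewrite /pay; apply: eq_bigr => c _; apply: eq_bigr => i _.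
  rewrite mulr_sumr; apply: eq_bigr => d _.
  by rewrite mulr_sumr; apply: eq_bigr => j _; rewrite mulrA.
have pay2 s' t' : - pay s' t' = \sum_d \sum_j t' d j * w2 s' d j.
  rewrite /pay; under eq_bigr do rewrite exchange_big/=.
  rewrite exchange_big/= -sumrN; apply: eq_bigr => d _.
  under eq_bigr do rewrite exchange_big/=.
  rewrite exchange_big/= -sumrN; apply: eq_bigr => j _.
  rewrite /w2 mulrN mulr_sumr; congr (- _); apply: eq_bigr => c _.
  by rewrite mulr_sumr; apply: eq_bigr => i _; rewrite mulrCA mulrA.
have mixed1 (A L : finType) (a : A -> L -> R) c i : is_mixed a -> `|a c i| <= 1.
  move=> /(_ c)[a0 a1]; rewrite ger0_norm// -a1 (bigD1 i)//= lerDl.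
  by rewrite sumr_ge0.
pose M : R := \sum_c \sum_i \sum_d \sum_j `|B c i d j|.
have w1M n c i : `|w1 (t n) c i| <= M.
  rewrite /M (bigD1 c)//= (bigD1 i)//= -addrA.
  apply: (@le_trans _ _ (\sum_d \sum_j `|B c i d j|)); last first.
    by rewrite lerDl addr_ge0 ?sumr_ge0// => *; repeat rewrite sumr_ge0// => *.
  apply: le_trans (ler_norm_sum _ _ _) _; apply: ler_sum => d _.
  apply: le_trans (ler_norm_sum _ _ _) _; apply: ler_sum => j _.
  by rewrite normrM ler_piMl// mixed1.
have w2M n d j : `|w2 (s n) d j| <= M.
  rewrite normrN /M; apply: le_trans (ler_norm_sum _ _ _) _.
  apply: ler_sum => c _; apply: le_trans (ler_norm_sum _ _ _) _.
  apply: ler_sum => i _; rewrite (bigD1 d)//= (bigD1 j)//= -addrA.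
  apply: (@le_trans _ _ `|B c i d j|); first by rewrite normrM ler_piMl// mixed1.
  by rewrite lerDl addr_ge0 ?sumr_ge0// => *; repeat rewrite sumr_ge0// => *.
have e20 : 0 < e / 2 by rewrite divr_gt0.
have [n1 H1] := @regret_matching C I i0 (fun n => (X n).1) (fun n => w1 (t n))
  M (e / 2) e20 w1M (fun _ _ => erefl) (fun _ _ _ => erefl).
have [n2 H2] := @regret_matching D J j0 (fun n => (X n).2) (fun n => w2 (s n))
  M (e / 2) e20 w2M (fun _ _ => erefl) (fun _ _ _ => erefl).
pose n := (maxn n1 n2).+1.
have n0 : 0 < n%:R :> R by rewrite ltr0n.
have nn1 : (n1 <= n)%N by rewrite leqW// leq_maxl.
have nn2 : (n2 <= n)%N by rewrite leqW// leq_maxr.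
pose avg (A L : finType) (a : nat -> A -> L -> R) c i : R :=
  n%:R^-1 * \sum_(k < n) a k c i.
have avgm (A L : finType) (a : nat -> A -> L -> R) :
    (forall k, is_mixed (a k)) -> is_mixed (avg A L a).
  move=> am c; split=> [i|].
    rewrite mulr_ge0 ?invr_ge0 ?ler0n ?sumr_ge0// => k _.
    by have [] := am k c.
  rewrite -mulr_sumr exchange_big/= (eq_bigr (fun=> 1)) => [|k _]; last first.
    by have [] := am k c.
  by rewrite sumr_const card_ord mulVf// lt0r_neq0.
exists (avg C I s), (avg D J t); split; [exact: avgm|exact: avgm|].
move=> s' t' s'm t'm.
have E1 : n%:R * pay s' (avg D J t) = \sum_(k < n) pay s' (t k).
  rewrite /pay mulr_sumr exchange_big/=; apply: eq_bigr => c _.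
  rewrite mulr_sumr exchange_big/=; apply: eq_bigr => i _.
  rewrite mulr_sumr exchange_big/=; apply: eq_bigr => d _.
  rewrite mulr_sumr exchange_big/=; apply: eq_bigr => j _.
  rewrite -mulr_suml -mulr_sumr /avg.
  by rewrite !mulrA (mulrAC _ _ n%:R^-1) mulfV ?lt0r_neq0// mul1r.
have E2 : n%:R * pay (avg C I s) t' = \sum_(k < n) pay (s k) t'.
  rewrite /pay mulr_sumr exchange_big/=; apply: eq_bigr => c _.
  rewrite mulr_sumr exchange_big/=; apply: eq_bigr => i _.
  rewrite mulr_sumr exchange_big/=; apply: eq_bigr => d _.
  rewrite mulr_sumr exchange_big/=; apply: eq_bigr => j _.
  rewrite -!mulr_suml /avg.
  by rewrite !mulrA mulfV ?lt0r_neq0// mul1r.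
have := H1 n nn1 s' s'm; have := H2 n nn2 t' t'm.
under eq_bigr do rewrite -pay2.
under [X in _ - X <= _ -> _]eq_bigr do rewrite -pay2.
under [X in _ -> X - _ <= _ -> _]eq_bigr do rewrite -pay1.
under [X in _ -> _ - X <= _ -> _]eq_bigr do rewrite -pay1.
rewrite !sumrN -E1 -E2 => h2 h1.
rewrite -(ler_pM2l n0) mulrDr; lra.
Qed.

End finite_games.

Lemma Delta_finE (R : realType) (T : finType) (p : T -> R) :
  Delta R T p <-> (forall t, 0 <= p t) /\ \sum_t p t = 1.
Proof.
have E : (forall t, 0 <= p t) ->
    (\esum_(t in [set: T]) (p t)%:E = (\sum_t p t)%:E)%E.
  move=> p0; rewrite esum_fset; last by move=> t _; rewrite lee_fin.
    rewrite (fsbigTE (seq_fset tt (enum T))) => [|t]; last first.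
      by rewrite seq_fsetE mem_enum.
    rewrite (perm_big (enum T)) ?big_enum ?sumEFin//.
    by rewrite -[X in perm_eq _ X]undup_id ?enum_uniq ?seq_fset_perm.
  exact: finite_finset.
by split=> -[p0]; [rewrite E// => -[]|move=> p1; split; rewrite ?E ?p1].
Qed.

Section expectation.
Context {R : realType} {T : choiceType}.
Variables (u : T -> R) (Du : Delta R T u).

Let mass_approx (e : R) : 0 < e ->
  exists A : {fset T}, 1 - e <= \sum_(x <- A) u x.
Proof.
move=> e0; have [u0 u1] := Du.
have : ((1 - e)%:E < \esum_(t in [set: T]) (u t)%:E)%E.
  by rewrite u1 lte_fin ltrBlDr ltrDl.
move=> /ereal_sup_gt[_ [A [finA _] <-]].
rewrite fsbig_finite//= sumEFin lte_fin => /ltW h.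
by exists (fset_set A).
Qed.

Let esum_split (A : {fset T}) (e : R) (h : T -> \bar R) :
  1 - e <= \sum_(x <- A) u x ->
  (forall x, 0 <= h x)%E -> (forall x, h x <= (u x)%:E)%E ->
  exists2 t : R, 0 <= t <= e &
    esum [set: T] h = (\sum_(x <- A) fine (h x) + t)%:E.
Proof.
move=> Ae h0 hu; have [u0 u1] := Du.
have split (f : T -> \bar R) : (forall x, 0 <= f x)%E ->
    esum [set: T] f = (\sum_(x <- A) f x + esum (~` [set` A]) f)%E.
  move=> f0; rewrite (esumID [set` A])// setTI setTI; congr (_ + _)%E.
  rewrite esum_fset//.
  by rewrite fsbig_finite//= set_fsetK.
have hfin x : h x = (fine (h x))%:E.
  rewrite fineK// fin_numElt (lt_le_trans (ltNyr 0))//=.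
  exact: le_lt_trans (hu x) (ltry _).
have hA : (\sum_(x <- A) h x = (\sum_(x <- A) fine (h x))%:E)%E.
  by rewrite -sumEFin; apply: eq_bigr => x _.
have u0' x : (0 <= (u x)%:E)%E by rewrite lee_fin.
have := split _ u0'; rewrite u1 sumEFin => U.
have tu : (esum (~` [set` A]) (fun x => (u x)%:E) <= e%:E)%E.
  have : (esum (~` [set` A]) (fun x => (u x)%:E) >= 0)%E by apply: esum_ge0.
  move: U; case: (esum _ _) => [r| |]//= [] rE _.
  by rewrite lee_fin; lra.
have t0 : (0 <= esum (~` [set` A]) h)%E by apply: esum_ge0.
have te : (esum (~` [set` A]) h <= e%:E)%E by apply: le_trans tu; exact: le_esum.
rewrite split// hA.
case: (esum _ _) t0 te => [r| |]//=; rewrite !lee_fin => r0 re.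
by exists r; rewrite ?r0.
Qed.

Lemma expect_approx (e : R) : 0 < e -> exists A : {fset T},
  \sum_(x <- A) u x <= 1 /\
  forall f : T -> R, (forall x, `|f x| <= 1) ->
    `|expect u f - \sum_(x <- A) u x * f x| <= e.
Proof.
move=> e0; have [A Ae] := mass_approx e0; have [u0 u1] := Du.
exists A; split.
  rewrite -lee_fin -sumEFin -u1; apply: esum_ge; exists [set` A].
    by split.
  by rewrite fsbig_finite//= set_fsetK.
move=> f f1.
have Fu x : `|u x * f x| <= u x by rewrite normrM ger0_norm// ler_piMr.
pose F x := (u x * f x)%:E.
have Fpos x : (F^\+ x)%E = (Num.max (u x * f x) 0)%:E by rewrite funeposE EFin_max.
have Fneg x : (F^\- x)%E = (Num.max (- (u x * f x)) 0)%:E.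
  by rewrite funenegE /F -EFinN EFin_max.
have [t1 /andP[t10 t1e] E1] : exists2 t : R, 0 <= t <= e &
    esum [set: T] (F^\+)%E = (\sum_(x <- A) fine ((F^\+)%E x) + t)%:E.
  apply: esum_split => // x; rewrite Fpos lee_fin ?le_max ?lexx ?orbT//.
  by rewrite ge_max u0 andbT (le_trans (ler_norm _)).
have [t2 /andP[t20 t2e] E2] : exists2 t : R, 0 <= t <= e &
    esum [set: T] (F^\-)%E = (\sum_(x <- A) fine ((F^\-)%E x) + t)%:E.
  apply: esum_split => // x; rewrite Fneg lee_fin ?le_max ?lexx ?orbT//.
  by rewrite ge_max u0 andbT (le_trans (ler_norm _))// normrN.
rewrite /expect -/F E1 E2 /=.
have -> : \sum_(x <- A) u x * f x =
    \sum_(x <- A) fine ((F^\+)%E x) - \sum_(x <- A) fine ((F^\-)%E x).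
  rewrite -sumrB; apply: eq_bigr => x _; rewrite Fpos Fneg/=.
  by case: (leP (u x * f x) 0); case: (leP (- (u x * f x)) 0); lra.
by rewrite ler_norml; lra.
Qed.

End expectation.

Section minimax.
Context {R : realType} {K I J : finType}.
Hypotheses (I0 : (0 < #|I|)%N) (J0 : (0 < #|J|)%N).
Variables (u : K * nat * nat -> R) (g : K -> I -> J -> R).
Hypotheses (Du : info_structure R K u) (gP : payoff_fun R K I J g).

Let stage s t (x : K * nat * nat) : R :=
  let: (k, c, d) := x in \sum_(i : I) \sum_(j : J) s c i * t d j * g k i j.

Let stage1 s t x : strategy R I s -> strategy R J t -> `|stage s t x| <= 1.
Proof.
case: x => -[k c] d sS tS.
have /Delta_finE[s0 s1] := sS c; have /Delta_finE[t0 t1] := tS d.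
apply: le_trans (ler_norm_sum _ _ _) _; rewrite -s1; apply: ler_sum => i _.
apply: le_trans (ler_norm_sum _ _ _) _.
rewrite -[leRHS]mulr1 -t1 mulr_sumr; apply: ler_sum => j _.
rewrite !normrM (ger0_norm (s0 i)) (ger0_norm (t0 j)) ler_piMr ?mulr_ge0//.
by rewrite ler_norml gP.
Qed.

Let payoff_bound s t : strategy R I s -> strategy R J t -> `|payoff u g s t| <= 2.
Proof.
move=> sS tS; have [A [A1 /(_ (stage s t))]] := expect_approx Du (@ltr01 R).
move=> /(_ (fun x => stage1 x sS tS)) h.
suff : `|\sum_(x <- A) u x * stage s t x| <= 1.
  by move: h; rewrite /payoff -/(stage s t) !ler_norml; lra.
apply: le_trans (ler_norm_sum _ _ _) _; apply: le_trans A1; apply: ler_sum => x _.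
by rewrite normrM (ger0_norm (Du.1 x)) ler_piMr ?(Du.1 x)// stage1.
Qed.

Let dirac (L : finType) (l : L) (c : nat) (i : L) : R := (i == l)%:R.

Let diracS (L : finType) (l : L) : strategy R L (dirac l).
Proof.
move=> c; apply/Delta_finE; split=> [i|]; first by rewrite ler0n.
by rewrite (bigD1 l)//= /dirac eqxx big1 ?addr0// => i /negbTE ->.
Qed.

Let eps_minimax (e : R) : 0 < e -> exists s t,
  [/\ strategy R I s, strategy R J t &
    forall s' t', strategy R I s' -> strategy R J t' ->
      payoff u g s' t <= payoff u g s t' + e].
Proof.
move=> e0; have e30 : 0 < e / 3 by rewrite divr_gt0.
have [A [_ Ae]] := expect_approx Du e30.
pose m := (\max_(x <- A) maxn x.1.2 x.2)%N.
have mA x : x \in A -> (x.1.2 < m.+1)%N /\ (x.2 < m.+1)%N.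
  move=> xA; suff : (maxn x.1.2 x.2 <= m)%N by rewrite geq_max !ltnS => /andP[].
  by rewrite /m (big_rem x)//= leq_maxl.
pose B (c : 'I_m.+1) (i : I) (d : 'I_m.+1) (j : J) : R :=
  \sum_(x <- A) (x.1.2 == c)%:R * (x.2 == d)%:R * (u x * g x.1.1 i j).
have [i0 _] := card_gt0P I0; have [j0 _] := card_gt0P J0.
have [s [t [sm tm st]]] := finite_game_minimax i0 j0 B e30.
have payE (s' : nat -> I -> R) (t' : nat -> J -> R) :
    \sum_(x <- A) u x * stage s' t' x =
    \sum_c \sum_i \sum_d \sum_j s' (val c) i * t' (val d) j * B c i d j.
  rewrite /B.
  under [RHS]eq_bigr => c _ do under eq_bigr => i _ do under eq_bigr => d _ do
    under eq_bigr => j _ do rewrite mulr_sumr.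
  under [RHS]eq_bigr => c _ do under eq_bigr => i _ do under eq_bigr => d _ do
    rewrite exchange_big/=.
  under [RHS]eq_bigr => c _ do under eq_bigr => i _ do rewrite exchange_big/=.
  under [RHS]eq_bigr => c _ do rewrite exchange_big/=.
  rewrite [RHS]exchange_big/= !big_seq; apply: eq_bigr => -[[k c] d] xA.
  have /=[cm dm] := mA _ xA.
  rewrite (bigD1 (Ordinal cm))//= [X in _ = _ + X]big1 ?addr0; last first.
    move=> c' cc'; rewrite big1// => i _; rewrite big1// => d' _; rewrite big1// => j _.
    suff -> : (c == c') = false by rewrite !mul0r mulr0.
    by apply/negbTE; apply: contra cc' => /eqP cc'; apply/eqP/val_inj.
  rewrite mulr_sumr; apply: eq_bigr => i _.
  rewrite (bigD1 (Ordinal dm))//= [X in _ = _ + X]big1 ?addr0; last first.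
    move=> d' dd'; rewrite big1// => j _.
    suff -> : (d == d') = false by rewrite mulr0 mul0r mulr0.
    by apply/negbTE; apply: contra dd' => /eqP dd'; apply/eqP/val_inj.
  rewrite mulr_sumr; apply: eq_bigr => j _.
  by rewrite !eqxx mulr1 mul1r; ring.
exists (fun c => s (inord c)), (fun d => t (inord d)).
have sS : strategy R I (fun c => s (inord c)) by move=> c; exact/Delta_finE/sm.
have tS : strategy R J (fun c => t (inord c)) by move=> c; exact/Delta_finE/tm.
split=> // s' t' s'S t'S.
have := st (fun c => s' (val c)) (fun d => t' (val d))
  (fun c => (Delta_finE _).1 (s'S _)) (fun c => (Delta_finE _).1 (t'S _)).
have -> : \sum_c \sum_i \sum_d \sum_j s' (val c) i * t d j * B c i d j =
    \sum_(x <- A) u x * stage s' (fun d => t (inord d)) x.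
  rewrite payE; apply: eq_bigr => c _; apply: eq_bigr => i _.
  by apply: eq_bigr => d _; apply: eq_bigr => j _; rewrite inord_val.
have -> : \sum_c \sum_i \sum_d \sum_j s c i * t' (val d) j * B c i d j =
    \sum_(x <- A) u x * stage (fun c => s (inord c)) t' x.
  rewrite payE; apply: eq_bigr => c _; apply: eq_bigr => i _.
  by apply: eq_bigr => d _; apply: eq_bigr => j _; rewrite inord_val.
have := Ae _ (fun x => stage1 x s'S tS); have := Ae _ (fun x => stage1 x sS t'S).
rewrite -!/(payoff u g _ _).
rewrite !ler_norml; lra.
Qed.

Lemma maxmin_minmax : maxmin u g = minmax u g.
Proof.
have [i0 _] := card_gt0P I0; have [j0 _] := card_gt0P J0.
pose si := dirac i0; pose tj := dirac j0.
have siS : strategy R I si by exact: diracS.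
have tjS : strategy R J tj by exact: diracS.
have pb s t : strategy R I s -> strategy R J t -> -2 <= payoff u g s t <= 2.
  by move=> ? ?; rewrite -ler_norml payoff_bound.
have infP s t : strategy R I s -> strategy R J t ->
    inf [set payoff u g s t' | t' in strategy R J] <= payoff u g s t.
  move=> sS tS; apply: ge_inf; last by exists t.
  by exists (-2) => _ [t' t'S <-]; have /andP[] := pb s t' sS t'S.
have supP s t : strategy R I s -> strategy R J t ->
    payoff u g s t <= sup [set payoff u g s' t | s' in strategy R I].
  move=> sS tS; apply: ub_le_sup; last by exists s.
  by exists 2 => _ [s' s'S <-]; have /andP[] := pb s' t s'S tS.
have maxminP s : strategy R I s ->
    inf [set payoff u g s t' | t' in strategy R J] <= maxmin u g.
  move=> sS; apply: ub_le_sup; last by exists s.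
  exists 2 => _ [s' s'S <-]; apply: le_trans (infP _ _ s'S tjS) _.
  by have /andP[] := pb _ _ s'S tjS.
have minmaxP t : strategy R J t ->
    minmax u g <= sup [set payoff u g s' t | s' in strategy R I].
  move=> tS; apply: ge_inf; last by exists t.
  exists (-2) => _ [t' t'S <-]; apply: le_trans (supP _ _ siS t'S).
  by have /andP[] := pb _ _ siS t'S.
apply/eqP; rewrite eq_le; apply/andP; split.
  apply: ge_sup => [|_ [s sS <-]]; first by eexists; exists si.
  apply: lb_le_inf => [|_ [t tS <-]]; first by eexists; exists tj.
  exact: le_trans (infP _ _ sS tS) (supP _ _ sS tS).
apply/ler_addgt0Pr => e e0; have [s [t [sS tS st]]] := eps_minimax e0.
apply: le_trans (minmaxP _ tS) _.
apply: ge_sup => [|_ [s' s'S <-]]; first by eexists; exists si.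
rewrite -lerBlDr; apply: le_trans (maxminP _ sS).
apply: lb_le_inf => [|_ [t' t'S <-]]; first by eexists; exists tj.
by rewrite lerBlDr st.
Qed.

End minimax.

Section overlap.
Context {R : realType} {K : finType}.

Let rowD : set 'rV[R]_#|K| :=
  [set x | (forall i, 0 <= x 0 i) /\ \sum_i x 0 i = 1].

Let rowD_compact : compact rowD.
Proof.
have cube : compact [set x : 'rV[R]_#|K| | forall i, x ord0 i \in `[0, 1] ].
  exact: (@rV_compact R #|K| (fun=> `[0, 1]%classic) (fun=> @segment_compact _ _ _)).
apply: subclosed_compact cube _; last first.
  move=> x [x0 x1] i; rewrite in_itv/= x0 -x1 (bigD1 i)//= lerDl.
  by rewrite sumr_ge0.
rewrite (_ : rowD = (\bigcap_(i in [set: 'I_#|K|])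
   ((fun x : 'rV[R]_#|K| => x 0 i) @^-1` [set y | 0 <= y]))
   `&` ((fun x : 'rV[R]_#|K| => \sum_i x 0 i) @^-1` [set y | y = 1])); last first.
  by apply/seteqP; split=> x [x0 x1]; split=> // i;
    first (by move=> _; exact: x0); exact: x0.
apply: closedI.
  apply: closed_bigI => i _; apply: preimage_closed; last exact: closed_ge.
  by move=> x _; exact: coord_continuous.
apply: preimage_closed; last exact: closed_eq.
move=> x _; apply: continuous_big; first exact: add_continuous.
by move=> i _; exact: coord_continuous.
Qed.

Lemma overlap_attained (p q : K -> R) : (0 < #|K|)%N ->
  exists p' q' : K -> R, [/\ Delta R K p', Delta R K q',
    overlap p q = \sum_k Num.min (p k * q' k) (p' k * q k) &
    forall p'' q'', Delta R K p'' -> Delta R K q'' ->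
      \sum_k Num.min (p k * q'' k) (p'' k * q k) <= overlap p q].
Proof.
move=> K0; have [k0 _] := card_gt0P K0.
pose f (x : 'rV[R]_#|K| * 'rV[R]_#|K|) : R :=
  \sum_k Num.min (p k * x.2 0 (enum_rank k)) (x.1 0 (enum_rank k) * q k).
pose row (r : K -> R) : 'rV[R]_#|K| := \row_i r (enum_val i).
pose unrow (x : 'rV[R]_#|K|) k := x 0 (enum_rank k).
have rowDE r : Delta R K r -> rowD (row r).
  move=> /Delta_finE[r0 r1]; split=> [i|]; first by rewrite mxE.
  rewrite -r1 (reindex_onto enum_rank enum_val)/= => [|i _]; last first.
    by rewrite enum_valK.
  rewrite (eq_bigl xpredT) => [|k]; last by rewrite enum_rankK eqxx.
  by apply: eq_bigr => k _; rewrite mxE enum_rankK.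
have unrowD x : rowD x -> Delta R K (unrow x).
  move=> [x0 x1]; apply/Delta_finE; split=> [k|]; first exact: x0.
  by rewrite -x1 [RHS](reindex enum_rank)//=; exact: onW_bij (@enum_rank_bij K).
have fE p' q' : f (row p', row q') = \sum_k Num.min (p k * q' k) (p' k * q k).
  by apply: eq_bigr => k _; rewrite !mxE enum_rankK.
have dK : Delta R K (fun k => (k == k0)%:R).
  apply/Delta_finE; split=> [k|]; first by rewrite ler0n.
  by rewrite (bigD1 k0)//= eqxx big1 ?addr0// => k /negbTE ->.
have fc : continuous f.
  apply: continuous_big; first exact: add_continuous.
  move=> k _ x.
  have c1 : {for x, continuous (fun v : 'rV[R]_#|K| * 'rV[R]_#|K| =>
      p k * v.2 0 (enum_rank k))}.
    apply: continuousM; first exact: cst_continuous.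
    apply: (@continuous_comp _ _ _ snd (fun y : 'rV[R]_#|K| => y 0 (enum_rank k))).
      exact: cvg_snd.
    exact: coord_continuous.
  have c2 : {for x, continuous (fun v : 'rV[R]_#|K| * 'rV[R]_#|K| =>
      v.1 0 (enum_rank k) * q k)}.
    apply: continuousM; last exact: cst_continuous.
    apply: (@continuous_comp _ _ _ fst (fun y : 'rV[R]_#|K| => y 0 (enum_rank k))).
      exact: cvg_fst.
    exact: coord_continuous.
  exact: (continuous_min c1 c2).
have [|[x y] /set_mem[/= xD yD] xymax] := @compact_EVT_max _ R f (rowD `*` rowD) _
    (compact_setX rowD_compact rowD_compact) (continuous_subspaceT fc).
  pose dk0 k : R := (k == k0)%:R.
  by exists (row dk0, row dk0); split; exact: (rowDE _ dK).
have fmax p'' q'' : Delta R K p'' -> Delta R K q'' ->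
    \sum_k Num.min (p k * q'' k) (p'' k * q k) <= f (x, y).
  by move=> ? ?; rewrite -fE; apply: xymax; apply/mem_set; split; exact: rowDE.
have oE : overlap p q = f (x, y).
  apply/eqP; rewrite eq_le; apply/andP; split.
    apply: ge_sup => [|_ [p'' p''D [q'' q''D <-]]]; last exact: fmax.
    by eexists; exists (unrow x); [exact: unrowD|exists (unrow y) => //; exact: unrowD].
  apply: ub_le_sup.
    by exists (f (x, y)) => _ [p'' p''D [q'' q''D <-]]; exact: fmax.
  by exists (unrow x); [exact: unrowD|exists (unrow y) => //; exact: unrowD].
exists (unrow x), (unrow y); split; [exact: unrowD|exact: unrowD|exact: oE|].
by move=> p'' q'' p''D q''D; rewrite oE; exact: fmax.
Qed.

End overlap.

(* Main.v *)
Require Import Defs.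
From mathcomp Require Import all_boot all_order all_algebra.
From mathcomp Require Import all_classical all_reals all_analysis.
From mathcomp Require Import finmap ring lra.
Import Order.TTheory GRing.Theory Num.Theory.
Local Open Scope ring_scope.

(** Write p and q for the marginals of u and v on the states.

    Lower bound: let the payoff be the sign of p k - q k, whatever the actions.
    Signals and actions are then irrelevant, the two values are the means of
    the sign under p and under q ([game_val_state]), and they differ by the
    l1 distance of p and q.

    Upper bound: giving a player less information can only hurt that player.
    So the value of u increases if player 2 ignores the signal of u, and the
    value of v decreases if player 1 ignores the signal of v; for fixed p' and
    q' in the simplex, what they play instead is chosen so that the two
    situations resemble each other. Let player 1 use a strategy s in u and
    player 2 a strategy t in v, and let S k and T k be the laws of the
    resulting actions given the state k ([conditional_action]). In u, player 2
    plays the mixture of the T l with weights q' l, independently of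
    everything: as if a signal of v were drawn for a fictitious state of law
    q'. In v, player 1 plays the mixture of the S l with weights p' l. The
    triple (state, action 1, action 2) then has the laws
      A (k, i, j) = p k * S k i * (sum over l of q' l * T l j)   in u,
      B (k, i, j) = q k * T k j * (sum over l of p' l * S l i)   in v.
    Keeping the term l = k of each mixture shows that both dominate
      min (p k * q' k) (p' k * q k) * S k i * T k j,
    whose total mass is the sum over k of min (p k * q' k) (p' k * q k). Two
    laws with a common part of mass m give means of a [-1, 1]-valued function
    that differ by at most 2 * (1 - m) ([mean_diff_le]), which bounds the
    difference of the payoffs ([decoupled_payoff_le]). Taking suprema and
    infima, with the value of v read as its upper value, bounds the
    difference of the values ([game_val_diff_le]); the best p' and q' give
    the overlap.

    If p = q, each term of the overlap is at most max p * q' k, and point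
    masses at a mode of p reach the bound ([overlap_self]). *)

(** * Expectations of bounded functions *)

Lemma ger0_expect {R : realType} {T : choiceType} {u f : T -> R} :
  (forall x, 0 <= u x) -> (forall x, 0 <= f x) ->
  expect u f = fine (\esum_(x in [set: T]) (u x * f x)%:E).
Proof.
move=> u0 f0; rewrite /expect.
set F := fun x => _.
have F0 x : (0 <= F x)%E by rewrite lee_fin mulr_ge0.
have neg0 : \esum_(x in [set: T]) (F^\- x)%E = 0%E.
  by apply: esum1 => x _; rewrite (ge0_funenegE (D := setT)) ?in_setT// => y _.
rewrite neg0 sube0; congr fine; apply: eq_esum => x _.
by rewrite (ge0_funeposE (D := setT)) ?in_setT// => y _.
Qed.

Lemma norm_expect_le1 {R : realType} {T : choiceType} {u : T -> R}
    (Du : Delta R T u) {f : T -> R} :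
  (forall x, `|f x| <= 1) -> `|expect u f| <= 1.
Proof.
move=> f1; apply/ler_addgt0Pr => e e0.
have [A [A1 /(_ f f1) h]] := expect_approx Du e0.
suff : `|\sum_(x <- A) u x * f x| <= 1 by move: h; rewrite !ler_norml; lra.
apply: le_trans (ler_norm_sum _ _ _) _; apply: le_trans A1.
by apply: ler_sum => x _; rewrite normrM (ger0_norm (Du.1 x)) ler_piMr ?(Du.1 x).
Qed.

(** Linearity, in the form needed for payoffs: outside a finite set of small
    complementary mass all the bounded functions involved are negligible at
    once, and on that set the identity is one between finite sums. *)
Lemma expect_lincomb {R : realType} {T : choiceType} {u : T -> R}
    (Du : Delta R T u) {M : finType} (a : M -> R) (f : M -> T -> R) {F : T -> R} :
  (forall m x, `|f m x| <= 1) -> (forall x, `|F x| <= 1) ->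
  (forall x, F x = \sum_m a m * f m x) ->
  expect u F = \sum_m a m * expect u (f m).
Proof.
move=> f1 F1 FE; apply/eqP; rewrite -subr_eq0 -normr_le0.
apply/ler_addgt0Pr => e e0; rewrite add0r.
(* Each of the functions F and f m contributes e / L, with weights 1 and
   |a m|, which add up to L. *)
pose L := 1 + \sum_m `|a m|.
have L0 : 0 < L by rewrite ltr_wpDr// sumr_ge0.
have [A [_ Ae]] := expect_approx Du (divr_gt0 e0 L0).
have AE : \sum_(x <- A) u x * F x = \sum_m a m * \sum_(x <- A) u x * f m x.
  under eq_bigr do rewrite FE mulr_sumr.
  rewrite exchange_big/=; apply: eq_bigr => m _.
  by rewrite mulr_sumr; apply: eq_bigr => x _; rewrite mulrCA.
have -> : expect u F - \sum_m a m * expect u (f m) =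
    (expect u F - \sum_(x <- A) u x * F x) -
    \sum_m a m * (expect u (f m) - \sum_(x <- A) u x * f m x).
  by under [X in _ = _ - X]eq_bigr do rewrite mulrBr; rewrite sumrB -AE; ring.
have -> : e = e / L + \sum_m `|a m| * (e / L).
  by rewrite -mulr_suml -{1}[e / L]mul1r -mulrDl -/L mulrCA divff ?mulr1 ?lt0r_neq0.
apply: le_trans (ler_normB _ _) _; apply: lerD; first exact: Ae.
apply: le_trans (ler_norm_sum _ _ _) _; apply: ler_sum => m _.
by rewrite normrM ler_wpM2l// Ae.
Qed.

(** * Mixed actions *)

Lemma Delta_le1 {R : realType} {T : finType} {p : T -> R} (t : T) :
  Delta R T p -> 0 <= p t <= 1.
Proof.
move=> /Delta_finE[p0 p1]; rewrite p0 -p1 (bigD1 t)//= lerDl.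
by rewrite sumr_ge0.
Qed.

Lemma Delta_mix {R : realType} {L T : finType} {w : L -> R} {P : L -> T -> R} :
  Delta R L w -> (forall l, Delta R T (P l)) ->
  Delta R T (fun t => \sum_l w l * P l t).
Proof.
move=> /Delta_finE[w0 w1] DP; apply/Delta_finE; split=> [t|].
  by rewrite sumr_ge0// => l _; rewrite mulr_ge0//; have /andP[] := Delta_le1 t (DP l).
rewrite exchange_big/= -w1; apply: eq_bigr => l _.
by rewrite -mulr_sumr; have /Delta_finE[_ ->] := DP l; rewrite mulr1.
Qed.

Lemma Delta_point {R : realType} {T : finType} (t0 : T) :
  Delta R T (fun t => (t == t0)%:R).
Proof.
apply/Delta_finE; split=> [t|]; first by rewrite ler0n.
by rewrite (bigD1 t0)//= eqxx big1 ?addr0// => t /negbTE ->.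
Qed.

Lemma norm_mean_le1 {R : realType} {T : finType} {p g : T -> R} :
  Delta R T p -> (forall t, `|g t| <= 1) -> `|\sum_t p t * g t| <= 1.
Proof.
move=> /Delta_finE[p0 p1] g1; apply: le_trans (ler_norm_sum _ _ _) _.
by rewrite -p1 ler_sum// => t _; rewrite normrM (ger0_norm (p0 t)) ler_piMr.
Qed.

(** * Payoffs against a constant strategy *)

Section BayesianGame.
Context {R : realType} {K : finType} {u : K * nat * nat -> R}.
Hypothesis Du : info_structure R K u.

(** Makes the marginal a mean, so that [expect_lincomb] applies to it. *)
Lemma marg_expect (k : K) : marg u k = expect u (fun x => (x.1.1 == k)%:R).
Proof.
have [u0 _] := Du.
rewrite ger0_expect// /marg; congr fine.
rewrite -(@reindex_esum R _ _ setT [set x : K * nat * nat | x.1.1 = k]%classic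
  (fun s => (k, s.1, s.2)) (fun x => (u x)%:E)).
  rewrite esum_mkcond; apply: eq_esum => x _; case: ifPn => [/set_mem/= <-|].
    by rewrite eqxx mulr1.
  by move=> /negP xk; case: eqP => [/mem_set//|_]; rewrite mulr0.
split=> [s _//|[a b] [c d] _ _ [-> ->]//|[[l c] d]/= ->].
by exists (c, d).
Qed.

(** S k is the law of the action given the state k, and sig selects the signal
    that the player sees; the product form also covers states of mass 0. *)
Lemma conditional_action {I : finType} {s : nat -> I -> R}
    (sig : K * nat * nat -> nat) : strategy R I s ->
  exists2 S : K -> I -> R, forall k, Delta R I (S k) &
    forall k i, expect u (fun x => (x.1.1 == k)%:R * s (sig x) i) = marg u k * S k i.
Proof.
move=> sS; have [u0 _] := Du.
pose E k i := expect u (fun x => (x.1.1 == k)%:R * s (sig x) i).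
have s01 x i : 0 <= s (sig x) i <= 1 by exact: Delta_le1 i (sS _).
have E0 k i : 0 <= E k i.
  rewrite /E ger0_expect => // [|x]; last first.
    by rewrite mulr_ge0// ?ler0n; case/andP: (s01 x i).
  apply: fine_ge0; apply: esum_ge0 => x _.
  by rewrite lee_fin mulr_ge0// mulr_ge0// ?ler0n; case/andP: (s01 x i).
have Esum k : \sum_i E k i = marg u k.
  rewrite marg_expect; under eq_bigr do rewrite -[E _ _]mul1r.
  rewrite -(expect_lincomb Du (fun=> 1)
    (fun i x => (x.1.1 == k)%:R * s (sig x) i) (F := fun x => (x.1.1 == k)%:R))//.
  - move=> i x; have /andP[s0 s1] := s01 x i.
    by rewrite normrM normr_nat (ger0_norm s0) mulr_ile1// lern1 leq_b1.
  - by move=> x; rewrite normr_nat lern1 leq_b1.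
  - move=> x; under eq_bigr do rewrite mul1r.
    by rewrite -mulr_sumr; have /Delta_finE[_ ->] := sS (sig x); rewrite mulr1.
(* For a state of mass 0, any mixed action will do, for instance the one played
   at the signal 0. *)
exists (fun k i => if marg u k == 0 then s 0%N i else E k i / marg u k).
  move=> k; apply/Delta_finE; case: (boolP (marg u k == 0)) => [_|m0]; first exact/Delta_finE.
  rewrite -mulr_suml Esum divff//; split=> // i.
  by rewrite divr_ge0// -Esum sumr_ge0.
move=> k i; rewrite -/(E k i); case: ifPn => [m0|m0]; last by rewrite mulrC divfK.
rewrite (eqP m0) mul0r; apply/eqP; move: m0; rewrite -Esum psumr_eq0//.
by move=> /allP/(_ i (mem_index_enum _))/= /eqP ->.
Qed.

Context {I J : finType} {g : K -> I -> J -> R}.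
Hypothesis gP : payoff_fun R K I J g.

Lemma stage_le1 (k : K) (a : I -> R) (b : J -> R) : Delta R I a -> Delta R J b ->
  `|\sum_i \sum_j a i * b j * g k i j| <= 1.
Proof.
move=> Da Db.
under eq_bigr do under eq_bigr do rewrite -mulrA.
under eq_bigr do rewrite -mulr_sumr.
do 2![apply: norm_mean_le1 => // ?].
by rewrite ler_norml gP.
Qed.

Lemma norm_payoff_le1 (s : nat -> I -> R) (t : nat -> J -> R) :
  strategy R I s -> strategy R J t -> `|payoff u g s t| <= 1.
Proof.
by move=> sS tS; apply: norm_expect_le1 => // -[[k c] d]; exact: stage_le1.
Qed.

(** When player 2 does not react to the signal, the payoff depends on u and s
    only through the joint law of the state and the action of player 1. *)
Lemma payoff_constr (s : nat -> I -> R) (b : J -> R) (S : K -> I -> R) :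
  strategy R I s -> Delta R J b ->
  (forall k i, expect u (fun x => (x.1.1 == k)%:R * s x.1.2 i) = marg u k * S k i) ->
  payoff u g s (fun=> b) = \sum_k \sum_i \sum_j marg u k * (S k i * b j * g k i j).
Proof.
move=> sS Db SE; rewrite /payoff.
rewrite (expect_lincomb Du (fun m : K * I => \sum_j b j * g m.1 m.2 j)
  (fun m x => (x.1.1 == m.1)%:R * s x.1.2 m.2)).
- rewrite pair_big/=; apply: eq_bigr => -[k i] _ /=.
  by rewrite SE mulr_suml; apply: eq_bigr => j _; ring.
- move=> [k i] [[l c] d]/=; have /andP[s0 s1] := Delta_le1 i (sS c).
  by rewrite normrM normr_nat (ger0_norm s0) mulr_ile1// lern1 leq_b1.
- by move=> [[k c] d]; exact: stage_le1.
- move=> [[k c] d]/=.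
  rewrite -(pair_big xpredT xpredT
    (fun l i => (\sum_j b j * g l i j) * ((k == l)%:R * s c i)))/=.
  rewrite (bigD1 k)//= [X in _ = _ + X]big1 ?addr0; last first.
    by move=> l lk; rewrite big1// => i _; rewrite eq_sym (negbTE lk) mul0r mulr0.
  apply: eq_bigr => i _; rewrite mulr_suml; apply: eq_bigr => j _.
  by rewrite eqxx mul1r; ring.
Qed.

Lemma payoff_constl (a : I -> R) (t : nat -> J -> R) (T : K -> J -> R) :
  Delta R I a -> strategy R J t ->
  (forall k j, expect u (fun x => (x.1.1 == k)%:R * t x.2 j) = marg u k * T k j) ->
  payoff u g (fun=> a) t = \sum_k \sum_i \sum_j marg u k * (a i * T k j * g k i j).
Proof.
move=> Da tS TE; rewrite /payoff.
rewrite (expect_lincomb Du (fun m : K * J => \sum_i a i * g m.1 i m.2)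
  (fun m x => (x.1.1 == m.1)%:R * t x.2 m.2)).
- under [RHS]eq_bigr do rewrite exchange_big/=.
  rewrite pair_big/=; apply: eq_bigr => -[k j] _ /=.
  by rewrite TE mulr_suml; apply: eq_bigr => i _; ring.
- move=> [k j] [[l c] d]/=; have /andP[t0 t1] := Delta_le1 j (tS d).
  by rewrite normrM normr_nat (ger0_norm t0) mulr_ile1// lern1 leq_b1.
- by move=> [[k c] d]; exact: stage_le1.
- move=> [[k c] d]/=.
  rewrite -(pair_big xpredT xpredT
    (fun l j => (\sum_i a i * g l i j) * ((k == l)%:R * t d j)))/=.
  rewrite (bigD1 k)//= [X in _ = _ + X]big1 ?addr0; last first.
    by move=> l lk; rewrite big1// => j _; rewrite eq_sym (negbTE lk) mul0r mulr0.
  rewrite exchange_big/=.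
  apply: eq_bigr => j _; rewrite mulr_suml; apply: eq_bigr => i _.
  by rewrite eqxx mul1r; ring.
Qed.

End BayesianGame.

(** * Comparing the values of two games *)

(** Pointwise, (A - B) g <= |A - B| = A + B - 2 min (A, B). *)
Lemma mean_diff_le {R : realType} {X : finType} {A B m g : X -> R} :
  Delta R X A -> Delta R X B -> (forall x, m x <= A x) -> (forall x, m x <= B x) ->
  (forall x, `|g x| <= 1) ->
  \sum_x A x * g x - \sum_x B x * g x <= 2 * (1 - \sum_x m x).
Proof.
move=> /Delta_finE[_ A1] /Delta_finE[_ B1] mA mB g1.
have -> : 2 * (1 - \sum_x m x) = \sum_x (A x + B x - 2 * m x).
  by rewrite sumrB big_split/= A1 B1 -mulr_sumr; ring.
rewrite -sumrB; apply: ler_sum => x _.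
have := g1 x; have := mA x; have := mB x; rewrite ler_norml.
by move=> ? ? /andP[? ?]; nra.
Qed.

Lemma joint_Delta {R : realType} {K I J : finType} {w : K -> R}
    {P : K -> I -> R} {Q : K -> J -> R} :
  Delta R K w -> (forall k, Delta R I (P k)) -> (forall k, Delta R J (Q k)) ->
  Delta R (K * I * J)%type (fun x => w x.1.1 * (P x.1.1 x.1.2 * Q x.1.1 x.2)).
Proof.
move=> /Delta_finE[w0 w1] DP DQ; apply/Delta_finE; split=> [[[k i] j]/=|].
  have /andP[? _] := Delta_le1 i (DP k); have /andP[? _] := Delta_le1 j (DQ k).
  by rewrite !mulr_ge0.
rewrite -(pair_big xpredT xpredT (fun (y : K * I) j => w y.1 * (P y.1 y.2 * Q y.1 j)))/=.
rewrite -(pair_big xpredT xpredT (fun k i => \sum_j w k * (P k i * Q k j)))/= -w1.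
apply: eq_bigr => k _; have /Delta_finE[_ P1] := DP k; have /Delta_finE[_ Q1] := DQ k.
under eq_bigr do rewrite -!mulr_sumr Q1 mulr1.
by rewrite -mulr_sumr P1 mulr1.
Qed.

(** The two triple sums are the means of g under the laws A and B described
    above; their common part is m k * S k i * T k j, where m k is the minimum
    in the conclusion. *)
Lemma decoupled_payoff_le {R : realType} {K I J : finType} {g : K -> I -> J -> R}
    {p q p' q' : K -> R} {S : K -> I -> R} {T : K -> J -> R} :
  payoff_fun R K I J g -> Delta R K p -> Delta R K q ->
  Delta R K p' -> Delta R K q' ->
  (forall k, Delta R I (S k)) -> (forall k, Delta R J (T k)) ->
  \sum_k \sum_i \sum_j p k * (S k i * (\sum_l q' l * T l j) * g k i j) -
  \sum_k \sum_i \sum_j q k * ((\sum_l p' l * S l i) * T k j * g k i j)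
  <= 2 * (1 - \sum_k Num.min (p k * q' k) (p' k * q k)).
Proof.
move=> gP Dp Dq Dp' Dq' DS DT.
have Db := Delta_mix Dq' DT; have Da := Delta_mix Dp' DS.
have flat (F : K -> I -> J -> R) :
    \sum_k \sum_i \sum_j F k i j = \sum_(x : K * I * J) F x.1.1 x.1.2 x.2.
  rewrite -(pair_big xpredT xpredT (fun (y : K * I) j => F y.1 y.2 j))/=.
  by rewrite -(pair_big xpredT xpredT (fun k i => \sum_j F k i j)).
pose m k : R := Num.min (p k * q' k) (p' k * q k).
have -> : \sum_k m k = \sum_(x : K * I * J) m x.1.1 * (S x.1.1 x.1.2 * T x.1.1 x.2).
  rewrite -(flat (fun k i j => m k * (S k i * T k j))).
  apply: eq_bigr => k _; have /Delta_finE[_ S1] := DS k; have /Delta_finE[_ T1] := DT k.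
  under eq_bigr do rewrite -!mulr_sumr T1 mulr1.
  by rewrite -mulr_sumr S1 mulr1.
rewrite !flat.
under eq_bigr do rewrite mulrA.
under [X in _ - X]eq_bigr do rewrite mulrA.
have term_le (w : K -> R) (L : finType) (P : K -> L -> R) k l : Delta R K w ->
    (forall k, Delta R L (P k)) -> w k * P k l <= \sum_h w h * P h l.
  move=> Dw DP; rewrite (bigD1 k)//= lerDl sumr_ge0// => h _.
  by rewrite mulr_ge0//; [case/andP: (Delta_le1 h Dw)|case/andP: (Delta_le1 l (DP h))].
apply: mean_diff_le.
- exact: (joint_Delta Dp DS (fun=> Db)).
- exact: (joint_Delta Dq (fun=> Da) DT).
- move=> [[k i] j]/=; have /andP[p0 _] := Delta_le1 k Dp.
  have /andP[S0 _] := Delta_le1 i (DS k); have /andP[T0 _] := Delta_le1 j (DT k).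
  have -> : p k * (S k i * \sum_l q' l * T l j) = p k * S k i * \sum_l q' l * T l j by ring.
  apply: (@le_trans _ _ (p k * S k i * (q' k * T k j))).
    have -> : p k * S k i * (q' k * T k j) = p k * q' k * (S k i * T k j) by ring.
    by rewrite ler_wpM2r ?mulr_ge0// /m ge_min lexx.
  by rewrite ler_wpM2l ?mulr_ge0// term_le.
- move=> [[k i] j]/=; have /andP[q0 _] := Delta_le1 k Dq.
  have /andP[S0 _] := Delta_le1 i (DS k); have /andP[T0 _] := Delta_le1 j (DT k).
  have -> : q k * ((\sum_l p' l * S l i) * T k j) = q k * T k j * \sum_l p' l * S l i by ring.
  apply: (@le_trans _ _ (q k * T k j * (p' k * S k i))).
    have -> : q k * T k j * (p' k * S k i) = p' k * q k * (S k i * T k j) by ring.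
    by rewrite ler_wpM2r ?mulr_ge0// /m ge_min lexx orbT.
  by rewrite ler_wpM2l ?mulr_ge0// term_le.
- by move=> [[k i] j]/=; rewrite ler_norml gP.
Qed.

(** The bound is one-sided because each player loses the information of one
    structure only: player 2 that of u, player 1 that of v. *)
Lemma game_val_diff_le {R : realType} {K I J : finType} {u v : K * nat * nat -> R}
    {g : K -> I -> J -> R} {p' q' : K -> R} :
  info_structure R K u -> info_structure R K v ->
  Delta R K (marg u) -> Delta R K (marg v) -> Delta R K p' -> Delta R K q' ->
  (0 < #|I|)%N -> (0 < #|J|)%N -> payoff_fun R K I J g ->
  game_val u g - game_val v g <=
    2 * (1 - \sum_k Num.min (marg u k * q' k) (p' k * marg v k)).
Proof.
move=> Du Dv Dp Dq Dp' Dq' I0 J0 gP.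
have [i0 _] := card_gt0P I0; have [j0 _] := card_gt0P J0.
rewrite /game_val (maxmin_minmax I0 J0 Dv gP).
set D := 2 * _.
pose s0 (_ : nat) i : R := (i == i0)%:R; pose t0 (_ : nat) j : R := (j == j0)%:R.
have s0S : strategy R I s0 by move=> c; exact: Delta_point.
have t0S : strategy R J t0 by move=> c; exact: Delta_point.
suff key s t : strategy R I s -> strategy R J t ->
    inf [set payoff u g s t' | t' in strategy R J]%classic - D <=
    sup [set payoff v g s' t | s' in strategy R I]%classic.
  rewrite lerBlDr /maxmin; apply: ge_sup => [|_ [s sS <-]]; first by eexists; exists s0.
  rewrite -lerBlDl; apply: lb_le_inf => [|_ [t tS <-]]; first by eexists; exists t0.
  exact: key.
move=> sS tS.
have [S DS SE] := conditional_action Du (fun x => x.1.2) sS.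
have [T DT TE] := conditional_action Dv (fun x => x.2) tS.
have Db := Delta_mix Dq' DT; have Da := Delta_mix Dp' DS.
have := decoupled_payoff_le gP Dp Dq Dp' Dq' DS DT.
rewrite -(payoff_constr Du gP _ _ _ sS Db SE) -(payoff_constl Dv gP _ _ _ Da tS TE) -/D.
(* The constant replies a in v and b in u are admissible deviations. *)
set b := fun j : J => _; set a := fun i : I => _ => le_D.
have hinf : inf [set payoff u g s t' | t' in strategy R J]%classic <=
    payoff u g s (fun=> b).
  apply: ge_inf; last by exists (fun=> b).
  exists (-1) => _ [t' t'S <-].
  by have := norm_payoff_le1 Du gP _ _ sS t'S; rewrite ler_norml => /andP[].
have hsup : payoff v g (fun=> a) t <=
    sup [set payoff v g s' t | s' in strategy R I]%classic.
  apply: ub_le_sup; last by exists (fun=> a).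
  exists 1 => _ [s' s'S <-].
  by have := norm_payoff_le1 Dv gP _ _ s'S tS; rewrite ler_norml => /andP[].
lra.
Qed.

(** Exchanging p' and q' as well as p and q leaves every candidate unchanged;
    this turns the one-sided bounds for (u, v) and (v, u) into one bound for
    the absolute value. *)
Lemma overlapC {R : realType} {K : finType} (p q : K -> R) : overlap p q = overlap q p.
Proof.
suff sub (p1 q1 : K -> R) : ([set \sum_k Num.min (p1 k * q' k) (p' k * q1 k)
      | p' in Delta R K & q' in Delta R K] `<=`
    [set \sum_k Num.min (q1 k * q' k) (p' k * p1 k)
      | p' in Delta R K & q' in Delta R K])%classic.
  by rewrite /overlap; congr sup; apply/seteqP; split; exact: sub.
move=> _ [p' Dp' [q' Dq' <-]]; exists q' => //; exists p' => //.
by apply: eq_bigr => k _; rewrite minC mulrC [q1 k * _]mulrC.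
Qed.

Lemma game_val_dist_le {R : realType} {K I J : finType} {u v : K * nat * nat -> R}
    {g : K -> I -> J -> R} : (0 < #|K|)%N ->
  info_structure R K u -> info_structure R K v ->
  Delta R K (marg u) -> Delta R K (marg v) ->
  (0 < #|I|)%N -> (0 < #|J|)%N -> payoff_fun R K I J g ->
  `|game_val u g - game_val v g| <= 2 * (1 - overlap (marg u) (marg v)).
Proof.
move=> K0 Du Dv Dp Dq I0 J0 gP; rewrite ler_norml lerNl opprB; apply/andP; split.
  have [p' [q' [Dp' Dq' + _]]] := overlap_attained (marg v) (marg u) K0.
  by rewrite overlapC => ->; exact: game_val_diff_le.
have [p' [q' [Dp' Dq' -> _]]] := overlap_attained (marg u) (marg v) K0.
exact: game_val_diff_le.
Qed.

(** * The two extreme cases *)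

Lemma overlap_self {R : realType} {K : finType} {p : K -> R} :
  (0 < #|K|)%N -> Delta R K p -> overlap p p = \big[Num.max/0]_k p k.
Proof.
move=> K0 Dp; have [k0 _] := card_gt0P K0.
have [p' [q' [Dp' /Delta_finE[q'0 q'1] oE omax]]] := overlap_attained p p K0.
apply/eqP; rewrite eq_le; apply/andP; split.
  rewrite oE -[leRHS]mulr1 -q'1 mulr_sumr; apply: ler_sum => k _.
  by rewrite ge_min ler_wpM2r// le_bigmax.
apply: bigmax_le => [|k _].
  rewrite oE sumr_ge0// => k _; have /andP[pk _] := Delta_le1 k Dp.
  by have /andP[p'k _] := Delta_le1 k Dp'; rewrite le_min !mulr_ge0.
apply: le_trans (omax _ _ (Delta_point k) (Delta_point k)).
rewrite (bigD1 k)//= eqxx mulr1 mul1r minxx lerDl sumr_ge0// => l /negbTE ->.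
by rewrite mulr0 mul0r minxx.
Qed.

(** With a single action each, the players have only one strategy, so the set
    of payoffs is a singleton. *)
Lemma game_val_state {R : realType} {K : finType} {u : K * nat * nat -> R}
    {g : K -> R} : info_structure R K u -> (forall k, -1 <= g k <= 1) ->
  game_val u (fun k (_ _ : unit) => g k) = \sum_k marg u k * g k.
Proof.
move=> Du gP.
have sS : strategy R unit (fun=> fun i => (i == tt)%:R) by move=> c; exact: Delta_point.
have payE s t : strategy R unit s -> strategy R unit t ->
    payoff u (fun k (_ _ : unit) => g k) s t = \sum_k marg u k * g k.
  move=> sS' tS; rewrite /payoff.
  rewrite (expect_lincomb Du g (fun k x => (x.1.1 == k)%:R)).
  - by apply: eq_bigr => k _; rewrite -marg_expect// mulrC.
  - by move=> k x; rewrite normr_nat lern1 leq_b1.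
  - by move=> [[k c] d]; apply: (stage_le1 (g := fun k _ _ => g k)) => // ? _ _.
  - move=> [[k c] d]/=; rewrite [RHS](bigD1 k)//= [X in _ = _ + X]big1 ?addr0; last first.
      by move=> l lk; rewrite eq_sym (negbTE lk) mulr0.
    have /Delta_finE[_ s1] := sS' c; have /Delta_finE[_ t1] := tS d.
    under eq_bigr do rewrite -mulr_suml -mulr_sumr t1 mulr1.
    by rewrite -mulr_suml s1 mul1r eqxx mulr1.
rewrite /game_val /maxmin.
have const (A : set (nat -> unit -> R)) (F : (nat -> unit -> R) -> R) x :
    (exists s, A s) -> (forall s, A s -> F s = x) ->
    ([set F s | s in A] = [set x])%classic.
  move=> [s0 As0] Fx; apply/seteqP; split=> [_ [s As <-]|_ ->]; first exact: Fx.
  by exists s0 => //; exact: Fx.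
rewrite (const _ _ (\sum_k marg u k * g k)) ?sup1//; first by eexists; exact: sS.
move=> s sS'; rewrite (const _ _ (\sum_k marg u k * g k)) ?inf1//.
  by eexists; exact: sS.
by move=> t tS; exact: payE.
Qed.

Theorem proposition1 (R : realType) (K : finType) (cardK : (2 <= #|K|)%N)
    (p q : K -> R) (hp : Delta R K p) (hq : Delta R K q)
    (u v : K * nat * nat -> R)
    (hu : info_structure R K u) (hv : info_structure R K v)
    (hup : marg u = p) (hvq : marg v = q) :
  [/\ \sum_(k : K) `|p k - q k| <= val_dist u v,
      val_dist u v <= 2 * (1 - overlap p q) &
      p = q -> 2 * (1 - overlap p q) = 2 * (1 - \big[Num.max/0]_(k : K) p k)].
Proof.
subst p q; have K0 : (0 < #|K|)%N by exact: ltnW.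
(* For this g, the sum of (p k - q k) * g k is the l1 distance of p and q. *)
pose g k : R := Num.sg (marg u k - marg v k).
have gP k : -1 <= g k <= 1 by rewrite -ler_norml normr_sg lern1 leq_b1.
have gE : `|game_val u (fun k (_ _ : unit) => g k) -
    game_val v (fun k (_ _ : unit) => g k)| = \sum_k `|marg u k - marg v k|.
  rewrite !game_val_state// -sumrB -[RHS]ger0_norm ?sumr_ge0//; congr `|_|.
  by apply: eq_bigr => k _; rewrite normrEsg -mulrBl mulrC.
split.
- rewrite -gE; apply: ub_le_sup.
    exists (2 * (1 - overlap (marg u) (marg v))) => _ [I [J [h [I0 J0 hP ->]]]].
    exact: game_val_dist_le.
  by exists unit, unit, (fun k _ _ => g k); split; rewrite ?card_unit// => k _ _.
- apply: ge_sup => [|_ [I [J [h [I0 J0 hP ->]]]]]; last exact: game_val_dist_le.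
  by eexists; exists unit, unit, (fun k _ _ => g k); split; rewrite ?card_unit// => k _ _.
- by move=> <-; rewrite overlap_self.
Qed.
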